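(* Let $m\ge 2$ and $r\ge 1$ be integers, and let $K_{m,r}=m+r-1-\left\lceil\frac{r-1}{m}\right\rceil$. The vector \[ (B_{m,r,1},\ldots,B_{m,r,K_{m,r}}) \] is palindromic if and only if $r\equiv 2\pmod m$.
   Context: For an integer $d\ge 0$, $\binom{Y}{d}$ denotes the polynomial $Y(Y-1)\cdots(Y-d+1)/d!$. For integers $m\ge2$, $r\ge1$ and $d=m+r-1$, the shifted-binomial coordinates $B_{m,r,k}\in\mathbb{Q}$ ($1\le k\le d+1$) are defined as the unique rational numbers satisfying the polynomial identity in $n$ \[ \binom{mn}{d}=\sum_{k=1}^{d+1}B_{m,r,k}\binom{n+k-1}{d} \] (the polynomials $\binom{n+k-1}{d}$, $1\le k\le d+1$, form a basis of the $\mathbb{Q}$-vector space of polynomials of degree at most $d$). The vector $(B_{m,r,1},\ldots,B_{m,r,K_{m,r}})$ is called palindromic if $B_{m,r,k}=B_{m,r,K_{m,r}+1-k}$ for every $1\le k\le K_{m,r}$. *)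

(* Defs.v *)
From mathcomp Require Import all_boot all_order all_algebra.

Set Implicit Arguments.
Unset Strict Implicit.
Unset Printing Implicit Defensive.

Import Order.TTheory GRing.Theory Num.Theory.
Local Open Scope ring_scope.

Definition binom_poly (d : nat) : {poly rat} :=
  (d`!%:R)^-1 *: \prod_(i < d) ('X - i%:R%:P).

Definition shifted_binom (d k : nat) : {poly rat} :=
  binom_poly d \Po ('X + (k%:R - 1)%:P).

Definition coord_degree (m r : nat) : nat := (m + r - 1)%N.

Definition dilated_binom (m r : nat) : {poly rat} :=
  binom_poly (coord_degree m r) \Po (m%:R *: 'X).

(* Entry i of c is the coordinate on shifted_binom d i.+1. *)
Definition is_coords (d : nat) (p : {poly rat}) (c : {ffun 'I_d.+1 -> rat}) : bool :=
  p == \sum_(i < d.+1) c i *: shifted_binom d i.+1.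

Lemma size_binom_poly d : (size (binom_poly d) <= d.+1)%N.
Proof.
apply: leq_trans (size_scale_leq _ _) _.
by rewrite size_prod_XsubC /index_enum -enumT size_enum_ord.
Qed.

Lemma binom_poly_nat d n : (binom_poly d).[n%:R] = 'C(n, d)%:R.
Proof.
have fact_neq0 : d`!%:R != 0 :> rat by rewrite pnatr_eq0 -lt0n fact_gt0.
rewrite hornerZ horner_prod; apply: (mulfI fact_neq0).
rewrite mulrA mulfV // mul1r -natrM mulnC bin_ffact ffact_prod natr_prod.
case: (leqP d n) => [le_dn | lt_nd].
  apply: eq_bigr => i _; rewrite !hornerE natrB //.
  by apply: leq_trans le_dn; apply: ltnW.
rewrite (bigD1 (Ordinal lt_nd)) //= !hornerE subrr mul0r.
by rewrite (bigD1 (Ordinal lt_nd)) //= subnn mul0r.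
Qed.

Lemma size_shifted_binom d k : (size (shifted_binom d k) <= d.+1)%N.
Proof.
rewrite /shifted_binom -[in 'X + _](opprK (_%:P)) -polyCN.
by rewrite size_comp_poly2 ?size_binom_poly // size_XsubC.
Qed.

Lemma size_dilated_binom m r : (size (dilated_binom m r) <= (coord_degree m r).+1)%N.
Proof.
apply: leq_trans (size_comp_poly_leq _ _) _; rewrite ltnS.
have size_mX : ((size (m%:R *: 'X : {poly rat})).-1 <= 1)%N.
  have := leq_trans (size_scale_leq m%:R 'X) (eq_leq (size_polyX rat)).
  by case: (size _) => [|[|[|]]].
apply: leq_trans (leq_mul (leqnn _) size_mX) _.
rewrite muln1 -subn1 leq_subLR add1n; exact: size_binom_poly.
Qed.

Lemma shifted_binom_nat d i n : (shifted_binom d i.+1).[n%:R] = 'C(n + i, d)%:R.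
Proof.
by rewrite /shifted_binom -natr1 addrK horner_comp hornerD hornerX hornerC -natrD binom_poly_nat.
Qed.

(* The shifted binomials form a basis of the polynomials of degree at most d:
   their values at d, d - 1, ..., 0 form a unitriangular matrix. *)
Lemma coords_exist_unique d (p : {poly rat}) : (size p <= d.+1)%N ->
  exists! c : {ffun 'I_d.+1 -> rat}, is_coords p c.
Proof.
move=> size_p.
pose M : 'M[rat]_d.+1 := \matrix_(i, j) (shifted_binom d i.+1).[(d - j)%:R].
pose v : 'rV[rat]_d.+1 := \row_j p.[(d - j)%:R].
have Munit : M \in unitmx.
  rewrite unitmxE det_trig; last first.
    apply/is_trig_mxP => i j lt_ij; rewrite mxE shifted_binom_nat bin_small //.
    have := ltn_ord j; rewrite ltnS => le_jd.
    by rewrite -[X in (_ < X)%N](subnK le_jd) ltn_add2l.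
  rewrite big1 ?unitr1 // => i _; rewrite mxE shifted_binom_nat subnK ?binn //.
  by rewrite -ltnS.
have coordsE (c : {ffun 'I_d.+1 -> rat}) :
    is_coords p c = (v == (\row_i c i) *m M).
  apply/eqP/eqP => [p_eq | v_eq].
    apply/rowP => j; rewrite !mxE p_eq horner_sum.
    by apply: eq_bigr => i _; rewrite !mxE hornerZ.
  apply/eqP; rewrite -subr_eq0; apply/eqP.
  apply: (@roots_geq_poly_eq0 _ _ [seq (d - j)%:R | j : 'I_d.+1]).
  - apply/allP => _ /mapP[j _ ->]; rewrite rootE hornerD hornerN horner_sum.
    move/rowP/(_ j): v_eq; rewrite !mxE => ->; rewrite subr_eq0.
    by apply/eqP/eq_bigr => i _; rewrite !mxE hornerZ.
  - rewrite map_inj_uniq ?enum_uniq // => j1 j2 /eqP; rewrite eqr_nat => /eqP eq_j.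
    by apply/val_inj; rewrite /= -(@subKn j1 d) -1?ltnS // eq_j subKn // -ltnS.
  rewrite size_map size_enum_ord.
  apply: leq_trans (size_polyD _ _) _; rewrite geq_max size_p size_polyN /=.
  apply: leq_trans (size_sum _ _ _) _; apply/bigmax_leqP => i _.
  by apply: leq_trans (size_scale_leq _ _) (size_shifted_binom _ _).
exists [ffun i => (v *m invmx M) 0 i]; split.
  rewrite coordsE; apply/eqP.
  have -> : \row_i [ffun i => (v *m invmx M) 0 i] i = v *m invmx M.
    by apply/rowP => i; rewrite mxE ffunE.
  by rewrite mulmxKV.
move=> c; rewrite coordsE => /eqP ->; apply/ffunP => i.
by rewrite ffunE mulmxK // mxE.
Qed.

Lemma dilated_binom_coords_exist m r :
  exists c : {ffun 'I_(coord_degree m r).+1 -> rat}, is_coords (dilated_binom m r) c.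
Proof.
by have [c [cP _]] := coords_exist_unique (size_dilated_binom m r); exists c.
Qed.

(* Meaningful for 1 <= k <= coord_degree m r + 1 only. *)
Definition shifted_binom_coord (m r k : nat) : rat :=
  xchoose (dilated_binom_coords_exist m r) (inord k.-1).

Lemma shifted_binom_coordP m r :
  dilated_binom m r =
    \sum_(1 <= k < (coord_degree m r).+2)
       shifted_binom_coord m r k *: shifted_binom (coord_degree m r) k.
Proof.
have /eqP p_eq := xchooseP (dilated_binom_coords_exist m r).
rewrite [LHS]p_eq.
rewrite big_add1 /= big_mkord; apply: eq_bigr => i _.
by rewrite /shifted_binom_coord /= inord_val.
Qed.

Lemma shifted_binom_coord_unique m r (B : nat -> rat) :
  dilated_binom m r =
    \sum_(1 <= k < (coord_degree m r).+2) B k *: shifted_binom (coord_degree m r) k ->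
  forall k, (1 <= k <= (coord_degree m r).+1)%N -> B k = shifted_binom_coord m r k.
Proof.
move=> B_eq [//|k] /= lt_k; rewrite /shifted_binom_coord /=.
have [c [_ c_uniq]] := coords_exist_unique (size_dilated_binom m r).
have <- : [ffun i : 'I_(coord_degree m r).+1 => B i.+1]
            = xchoose (dilated_binom_coords_exist m r).
  rewrite -(c_uniq _ (xchooseP (dilated_binom_coords_exist m r))).
  apply/esym/c_uniq/eqP; rewrite B_eq big_add1 /= big_mkord.
  by apply: eq_bigr => i _; rewrite ffunE.
by rewrite ffunE inordK.
Qed.

Definition palindrome_length (m r : nat) : nat :=
  (m + r - 1 - `|Num.ceil ((r%:R - 1) / m%:R : rat)|)%N.

Definition palindromic (K : nat) (B : nat -> rat) : Prop :=
  forall k : nat, (1 <= k <= K)%N -> B k = B (K + 1 - k)%N.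

(* Main.v *)
Require Import Defs.
From mathcomp Require Import all_boot all_order all_algebra.
From mathcomp Require Import zify ring lra.

(** With [d = m + r - 1], let [c s] be the coefficient of [X^s] in
    [(1 + X + ... + X^(m-1))^(d+1)]. The theorem rests on the closed form
    [B_k = c (m k - 1)] ([shifted_binom_coordE]).

    The closed form comes from [(1 - X) (1 + ... + X^(m-1)) = 1 - X^m]: since
    [1 / (1 - X)^(d+1)] generates the numbers [C(t + d, d)], comparing the
    coefficients of [X^N] in
    [1 / (1 - X)^(d+1) = (1 + ... + X^(m-1))^(d+1) / (1 - X^m)^(d+1)] gives
    [C(N + d, d) = \sum_t c (N - m t) C(t + d, d)] ([multichoose_box_conv]).
    The reciprocity [C(- n, d) = (-1)^d C(n + d - 1, d)] shows that this identity
    at [N = m n - 1] is the expansion defining the [B_k], evaluated at [- n].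

    Now [c] is supported on the integers from [0] to [N0 = (m - 1) (d + 1)], it
    satisfies [c s = c (N0 - s)], and [c s = C(s + d, d)] for [s < m]. The
    number [K] of the theorem is the last [k] with [m k - 1 <= N0]
    ([palindrome_length_bounds]). Hence [N0 - (m K - 1)] is between 0 and [m - 1], and
    palindromicity at [k = 1] says that [c (m - 1) = c (N0 - (m K - 1))] with both
    arguments in the range where [c] is injective. So it forces
    [m (K + 1) = N0 + 2]; conversely, under this equation palindromicity is the
    symmetry of [c]. Finally [m (K + 1) = N0 + 2] holds exactly when [m] divides
    [N0 + 2], which is congruent to [2 - r] modulo [m]. *)

Set Implicit Arguments.
Unset Strict Implicit.
Unset Printing Implicit Defensive.

Import Order.TTheory GRing.Theory Num.Theory.
Local Open Scope ring_scope.

(** * Powers of 1 + X + ... + X^(m-1) *)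

Definition box_poly (m D : nat) : {poly rat} := (\sum_(i < m) 'X^i) ^+ D.

Arguments box_poly : simpl never.

Lemma coef_box_polyS m D s :
  (box_poly m D.+1)`_s =
    \sum_(i < m) (if (s < i)%N then 0 else (box_poly m D)`_(s - i)).
Proof.
rewrite /box_poly exprS mulr_suml coef_sum.
by apply: eq_bigr => i _; rewrite coefXnM.
Qed.

Lemma coef_box_poly_out m D s : (m.-1 * D < s)%N -> (box_poly m D)`_s = 0.
Proof.
elim: D s => [|D IHD] s lt_s.
  by rewrite /box_poly expr0 coef1; case: eqP lt_s => // ->; rewrite muln0.
rewrite coef_box_polyS big1 // => i _; case: ltnP => // le_is.
by apply: IHD; have := ltn_ord i; rewrite mulnS in lt_s; lia.
Qed.

(** Reversing the coefficients of each factor [1 + ... + X^(m-1)] leaves it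
    unchanged. In the induction the index of the extra factor is reversed, and a
    summand that is cut off by truncated subtraction on one side corresponds to a
    coefficient beyond the degree on the other. *)
Lemma coef_box_poly_sym m D s t : (s + t = m.-1 * D)%N ->
  (box_poly m D)`_s = (box_poly m D)`_t.
Proof.
elim: D s t => [|D IHD] s t st.
  by have [-> ->] : s = 0%N /\ t = 0%N by lia.
rewrite !coef_box_polyS [RHS](reindex_inj rev_ord_inj) /=.
apply: eq_bigr => i _; have lt_im := ltn_ord i; rewrite mulnS in st.
case: (ltnP s i) => [lt_si | le_is]; case: ltnP => [lt_t | le_t] //.
- by rewrite coef_box_poly_out //; lia.
- by rewrite coef_box_poly_out //; lia.
- by apply: IHD; lia.
Qed.

(** * Comparison of the expansions of 1 / (1 - X)^(d+1) and 1 / (1 - X^m)^(d+1) *)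

(** The expansion of [1 / (1 - X)^(d+1)] truncated at order [T]. *)
Definition multichoose_poly (d T : nat) : {poly rat} :=
  \poly_(t < T) 'C(t + d, d)%:R.

Lemma dvdXn_coef (T : nat) (p : {poly rat}) :
  ('X^T %| p) <-> forall i, (i < T)%N -> p`_i = 0.
Proof.
split=> [/dvdpP[q ->] i lt_iT | p0]; first by rewrite coefMXn lt_iT.
apply/dvdpP; exists (drop_poly T p); rewrite -[LHS](poly_take_drop T).
suff -> : take_poly T p = 0 by rewrite add0r.
by apply/polyP => i; rewrite coef_take_poly coef0; case: ifP => // /p0.
Qed.

(** Multiplication by [1 - X] takes differences of consecutive coefficients, so by
    Pascal's rule it lowers [d] by one, up to order [T]. *)
Lemma multichoose_poly_inv d T :
  'X^T %| (1 - 'X) ^+ d.+1 * multichoose_poly d T - 1.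
Proof.
have step (e : nat) (q : {poly rat}) :
    (forall i, (i < T)%N -> q`_i = 'C(i + e, e)%:R - (if i is j.+1 then 'C(j + e, e)%:R else 0)) ->
    'X^T %| (1 - 'X) * multichoose_poly e T - q.
  move=> qE; apply/dvdXn_coef => i lt_iT.
  rewrite mulrBl mul1r !coefB coefXM !coef_poly lt_iT qE //.
  case: i lt_iT => [|j] lt_jT /=; first by ring.
  by rewrite (ltnW lt_jT); ring.
elim: d => [|d IHd].
  by rewrite expr1; apply: step => -[|i] _; rewrite coef1 !bin0.
rewrite exprSr -mulrA.
have -> : (1 - 'X) ^+ d.+1 * ((1 - 'X) * multichoose_poly d.+1 T) - 1
   = (1 - 'X) ^+ d.+1 * ((1 - 'X) * multichoose_poly d.+1 T - multichoose_poly d T)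
     + ((1 - 'X) ^+ d.+1 * multichoose_poly d T - 1) by ring.
apply: dvdp_add => //; apply: dvdp_mull; apply: step => i lt_iT.
rewrite coef_poly lt_iT; case: i lt_iT => [|i] _; first by rewrite !add0n !binn subr0.
by rewrite addnS binS addSnnS natrD [X in _ = X]addrAC subrr add0r.
Qed.

(** Modulo [X^(N+1)], both [A] and [box_poly m d.+1 * (A \Po X^m)] are inverses of
    [(1 - X)^(d+1)], where [A] is the truncated expansion; so they have the same
    coefficient at [X^N]. *)
Lemma multichoose_box_conv m d N : (0 < m)%N ->
  'C(N + d, d)%:R =
    \sum_(t < N.+1) 'C(t + d, d)%:R *
       (if (N < m * t)%N then 0 else (box_poly m d.+1)`_(N - m * t)) :> rat.
Proof.
move=> m_gt0; pose T := N.+1; pose A := multichoose_poly d T.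
pose Q := (1 - 'X : {poly rat}) ^+ d.+1.
have dvdQA : 'X^T %| Q * A - 1 := multichoose_poly_inv d T.
have QP : Q * box_poly m d.+1 = (1 - 'X^m) ^+ d.+1.
  rewrite /Q /box_poly -exprMn; congr (_ ^+ _).
  by rewrite -[RHS]opprB subrX1 -mulNr opprB.
have dvdQPA : 'X^T %| Q * box_poly m d.+1 * (A \Po 'X^m) - 1.
  have /dvdpP[q qE] := dvdQA; rewrite QP.
  have -> : (1 - 'X^m) ^+ d.+1 * (A \Po 'X^m) - 1 = (Q * A - 1) \Po 'X^m.
    by rewrite /Q comp_polyB comp_polyM rmorphXn /= comp_polyB comp_polyX !comp_polyC.
  rewrite qE comp_polyM comp_Xn_poly; apply: dvdp_mull.
  by rewrite -exprM dvdp_exp2l // leq_pmull.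
have /dvdXn_coef/(_ N (ltnSn N)) : 'X^T %| A - box_poly m d.+1 * (A \Po 'X^m).
  have -> : A - box_poly m d.+1 * (A \Po 'X^m) =
     A * (- (Q * box_poly m d.+1 * (A \Po 'X^m) - 1))
     + box_poly m d.+1 * (A \Po 'X^m) * (Q * A - 1) by ring.
  by apply: dvdp_add; apply: dvdp_mull; rewrite ?dvdpNr.
rewrite coefB coef_poly ltnSn => /eqP; rewrite subr_eq0 => /eqP ->.
rewrite /A /multichoose_poly poly_def rmorph_sum /= mulr_sumr coef_sum.
apply: eq_bigr => t _.
by rewrite comp_polyZ comp_Xn_poly -exprM -scalerAr coefZ coefMXn.
Qed.

(** For [s < m] only the term [t = 0] of the convolution survives. *)
Lemma coef_box_poly_small m d s : (s < m)%N ->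
  (box_poly m d.+1)`_s = 'C(s + d, d)%:R.
Proof.
move=> lt_sm; rewrite (@multichoose_box_conv m) ?(leq_ltn_trans (leq0n s)) //.
rewrite big_ord_recl /= muln0 subn0 add0n binn mul1r [X in _ + X]big1 ?addr0 // => t _.
by rewrite /= /bump /= mulnS ltn_addr ?mulr0.
Qed.

Lemma multichoose_inj d s t : (0 < d)%N ->
  'C(s + d, d) = 'C(t + d, d) -> s = t.
Proof.
move=> d_gt0; wlog lt_st: s t / (s < t)%N.
  move=> W; have [/W H|/W H|//] := ltngtP s t; first exact: H.
  by move=> /esym /H.
suff : ('C(s + d, d) < 'C(t + d, d))%N by move=> + eqC; rewrite eqC ltnn.
apply: (@leq_trans 'C((s + d).+1, d)).
  case: d d_gt0 => // d _; rewrite [X in (_ < X)%N]binS -addn1 leq_add2l bin_gt0; lia.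
by apply: leq_bin2l; lia.
Qed.

(** * The coordinates as coefficients *)

Lemma binom_poly_neg d n : (0 < n)%N ->
  (binom_poly d).[- n%:R] = (-1) ^+ d * 'C(n.-1 + d, d)%:R.
Proof.
move=> n_gt0.
have fact_neq0 : d`!%:R != 0 :> rat by rewrite pnatr_eq0 -lt0n fact_gt0.
rewrite hornerZ horner_prod; apply: (mulfI fact_neq0).
rewrite mulrA mulfV // mul1r mulrCA -natrM mulnC bin_ffact ffact_prod natr_prod.
rewrite [in RHS](reindex_inj rev_ord_inj) /=.
rewrite -[d in (-1) ^+ d](card_ord d) -prodr_const -big_split /=.
apply: eq_bigr => i _; rewrite !hornerE.
have -> : (n.-1 + d - (d - i.+1) = n + i)%N by have := ltn_ord i; lia.
by rewrite natrD; ring.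
Qed.

Lemma shifted_binom_neg d k n : (0 < k <= n)%N ->
  (shifted_binom d k).[- n%:R] = (-1) ^+ d * 'C(n - k + d, d)%:R.
Proof.
move=> /andP[k_gt0 le_kn]; rewrite /shifted_binom horner_comp hornerD hornerX hornerC.
have -> : - n%:R + (k%:R - 1) = - (n - k).+1%:R :> rat.
  by rewrite -natr1 natrB //; ring.
by rewrite binom_poly_neg.
Qed.

Lemma dilated_binom_neg m r n : (0 < m)%N -> (0 < n)%N ->
  (dilated_binom m r).[- n%:R] =
    (-1) ^+ coord_degree m r * 'C((m * n).-1 + coord_degree m r, coord_degree m r)%:R.
Proof.
move=> m_gt0 n_gt0; rewrite /dilated_binom horner_comp [(_ *: 'X).[_]]hornerZ hornerX mulrN -natrM.
by rewrite binom_poly_neg // muln_gt0 m_gt0.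
Qed.

(** Substituting [k = n - t] in the convolution at [N = m n - 1] turns the argument
    [N - m t] into [m k - 1]; the terms with [k > d + 1] vanish because this
    argument exceeds the degree of [box_poly]. *)
Lemma multichoose_dilation m d n : (0 < m)%N -> (d < n)%N ->
  'C((m * n).-1 + d, d)%:R =
    \sum_(1 <= k < d.+2) (box_poly m d.+1)`_(m * k).-1 * 'C(n - k + d, d)%:R :> rat.
Proof.
move=> m_gt0 lt_dn; have mn_gt0 : (0 < m * n)%N by rewrite muln_gt0 m_gt0; lia.
rewrite (multichoose_box_conv d _ m_gt0) prednK //.
pose F t : rat := 'C(t + d, d)%:R *
  (if (m * n <= m * t)%N then 0 else (box_poly m d.+1)`_((m * n).-1 - m * t)).
rewrite -(big_mkord xpredT F) (big_cat_nat (n := n)) //=; last exact: leq_pmull.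
rewrite [X in _ + X]big_nat_cond [X in _ + X]big1 ?addr0; last first.
  by move=> t /andP[/andP[le_nt _] _]; rewrite /F leq_mul2l le_nt orbT mulr0.
rewrite big_nat_rev add0n -(big_add1 _ _ 0 n.+1 xpredT (fun k => F (n - k)%N)) /F.
rewrite (big_cat_nat (n := d.+2)) //= [X in _ + X]big_nat_cond [X in _ + X]big1 ?addr0.
  rewrite big_nat_cond [RHS]big_nat_cond; apply: eq_bigr => k.
  rewrite andbT => /andP[k_gt0 lt_kd]; rewrite mulrC; congr (_ * _).
  have le_m_mk : (m <= m * k)%N by rewrite leq_pmulr.
  have le_mk_mn : (m * k <= m * n)%N by rewrite leq_mul2l; lia.
  rewrite mulnBr ifF; last by lia.
  by congr (_`_ _); lia.
move=> k; rewrite andbT => /andP[lt_dk lt_kn].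
case: ifP => [|_]; first by rewrite mulr0.
rewrite coef_box_poly_out ?mulr0 // mulnBr.
have le_mdk : (m * d.+2 <= m * k)%N by rewrite leq_mul2l lt_dk orbT.
have le_mk_mn : (m * k <= m * n)%N by rewrite leq_mul2l; lia.
have le_pred : (m.-1 * d.+1 <= m * d.+1)%N by rewrite leq_mul2r leq_pred orbT.
by rewrite mulnS in le_mdk; lia.
Qed.

(** By uniqueness of the coordinates it suffices to check a polynomial identity of
    degree at most [d] at the [d + 1] points [- n] with [d < n < 2 d + 2]. *)
Lemma shifted_binom_coordE m r k : (0 < m)%N ->
  (1 <= k <= (coord_degree m r).+1)%N ->
  shifted_binom_coord m r k = (box_poly m (coord_degree m r).+1)`_(m * k).-1.
Proof.
move=> m_gt0 k_bnd; apply/esym.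
apply: (@shifted_binom_coord_unique m r
  (fun k => (box_poly m (coord_degree m r).+1)`_(m * k).-1)) => // {k k_bnd}.
have := size_dilated_binom m r; have := dilated_binom_neg r m_gt0.
move: (dilated_binom m r) (coord_degree m r) => p d pE size_p.
apply/eqP; rewrite -subr_eq0; apply/eqP.
apply: (@roots_geq_poly_eq0 _ _ [seq - (d.+1 + i)%:R | i <- iota 0 d.+1]).
- apply/allP => _ /mapP[i _ ->]; rewrite rootE hornerD hornerN horner_sum.
  rewrite pE // multichoose_dilation ?leq_addr // mulr_sumr subr_eq0; apply/eqP.
  apply: eq_big_nat => k /andP[k_gt0 lt_k].
  rewrite hornerZ shifted_binom_neg ?k_gt0 /=; last by lia.
  by rewrite mulrCA.
- rewrite map_inj_uniq ?iota_uniq // => i j /oppr_inj/eqP.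
  by rewrite eqr_nat eqn_add2l => /eqP.
rewrite size_map size_iota; apply: leq_trans (size_polyD _ _) _.
rewrite geq_max size_p size_polyN; apply: leq_trans (size_sum _ _ _) _.
apply/bigmax_leqP_seq => k _ _.
by apply: leq_trans (size_scale_leq _ _) (size_shifted_binom _ _).
Qed.

(** * The palindrome criterion *)

(** Both bounds unfold to [r - 1 <= m q < r - 1 + m] for the ceiling [q] of
    [(r - 1) / m]. They identify the last index [k] for which [m k - 1] stays in the
    support of the coefficients of [box_poly m (coord_degree m r).+1]. *)
Lemma palindrome_length_bounds m r : (0 < m)%N -> (0 < r)%N ->
  (m * palindrome_length m r <= (m.-1 * (coord_degree m r).+1).+1
     < m * (palindrome_length m r).+1)%N.
Proof.
move=> m_gt0 r_gt0; rewrite /palindrome_length /coord_degree.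
set x := (_ / _ : rat); have mQ_gt0 : 0 < m%:R :> rat by rewrite ltr0n.
have x_ge0 : 0 <= x by rewrite divr_ge0 ?ler0n // subr_ge0 ler1n.
have ceil_x_ge0 : (0 <= Num.ceil x) by rewrite ceil_ge0 (lt_le_trans _ x_ge0).
have [] := andP (ceil_itv x); move: ceil_x_ge0.
case: (Num.ceil x) => // a _; rewrite absz_nat.
rewrite ltr_pdivlMr // ler_pdivrMr // intrB ltrBrDr => lt_a le_a.
have {}lt_a : (m * a < m + r - 1)%N.
  have : (m * a)%:R + 1 < m%:R + r%:R :> rat.
    by move: lt_a; rewrite natrM -[a%:~R]/(a%:R); lra.
  by rewrite -natrD natr1 ltr_nat; lia.
have {}le_a : (r <= (m * a).+1)%N.
  rewrite -(ler_nat rat) -natr1 natrM.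
  by move: le_a; rewrite -[a%:~R]/(a%:R); lra.
have -> : m.-1 = (m - 1)%N by lia.
by rewrite mulnS !mulnBr mulnBl mulnS; nia.
Qed.

Local Close Scope ring_scope.

Theorem theorem4p3 (m r : nat) (hm : (2 <= m)%N) (hr : (1 <= r)%N) :
  palindromic (palindrome_length m r) (shifted_binom_coord m r)
    <-> r = 2 %[mod m].
Proof.
have m_gt0 : (0 < m)%N by lia.
have := palindrome_length_bounds m_gt0 hr.
have le_Kd : (palindrome_length m r <= coord_degree m r)%N by exact: leq_subr.
have coordE k : (0 < k <= palindrome_length m r)%N ->
    shifted_binom_coord m r k = ((box_poly m (coord_degree m r).+1)`_(m * k).-1)%R.
  by move=> k_bnd; apply: shifted_binom_coordE; lia.
have dE : coord_degree m r = m + r - 1 by [].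
move: le_Kd coordE dE; move: (palindrome_length m r) (coord_degree m r) => K d.
move=> le_Kd coordE dE /andP[le_mK lt_mK].
have N0E : m.-1 * d.+1 + d.+1 = m * d + m by rewrite -mulSnr prednK // mulnS addnC.
(* For N0 = (m - 1) (d + 1), the relation N0 + 2 + r = m d + 2 makes N0 + 2
   congruent to 2 - r. *)
have mod2E : r = 2 %[mod m] <-> m %| (m.-1 * d.+1).+2.
  have := eqn_modDr r (m.-1 * d.+1).+2 0 m.
  have -> : (m.-1 * d.+1).+2 + r = d * m + 2 by rewrite (mulnC d); lia.
  rewrite modnMDl add0n mod0n /dvdn => <-.
  by split=> [-> | /eqP].
have le_mN0 : m <= (m.-1 * d.+1).+1.
  by rewrite -[X in X <= _](prednK m_gt0) ltnS leq_pmulr.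
have symc := @coef_box_poly_sym m d.+1.
have d_gt0 : 0 < d by lia.
rewrite mod2E {mod2E N0E dE}; move: (m.-1 * d.+1) le_mK lt_mK le_mN0 symc => N le_mK lt_mK le_mN0 symc.
have -> : m %| N.+2 <-> m * K.+1 = N.+2.
  split=> [/dvdnP[q qE] | <-]; last exact: dvdn_mulr.
  have lt_Kq : K < q by rewrite -(ltn_pmul2l m_gt0) [m * q]mulnC -qE.
  have lt_qK : q < K.+2.
    by rewrite -(ltn_pmul2r m_gt0) -qE mulnC mulnS; move: lt_mK; lia.
  by rewrite qE mulnC; congr (_ * m); lia.
have mK_gt0 k : 0 < k -> 0 < m * k by rewrite muln_gt0 m_gt0.
split=> [pal | mKE k k_bnd].
  have K_gt0 : 0 < K by rewrite -ltnS -(ltn_pmul2l m_gt0) muln1 (leq_ltn_trans le_mN0).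
  have := pal 1; rewrite K_gt0 !coordE ?addnK ?K_gt0 ?leqnn // muln1 => /(_ isT).
  have := mK_gt0 _ K_gt0; rewrite mulnS in lt_mK * => mK_pos.
  (* Reflection moves the index m K - 1 below m, where the coefficients are
     distinct binomials. *)
  rewrite (symc (m * K).-1 (N.+1 - m * K)); last by lia.
  rewrite !coef_box_poly_small; try lia.
  by move/eqP; rewrite eqr_nat => /eqP/multichoose_inj; lia.
rewrite !coordE; try lia.
apply: symc; have kE : m * k + m * (K + 1 - k) = N.+2.
  by rewrite -mulnDr -mKE; congr (_ * _); lia.
have mk_gt0 : 0 < m * k by apply: mK_gt0; lia.
have mk'_gt0 : 0 < m * (K + 1 - k) by apply: mK_gt0; lia.
by move: (m * k) (m * _) mk_gt0 mk'_gt0 kE => a b; clear; lia.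
Qed.
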